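(* For any $\delta$-triple $\delta=(\alpha,\beta,\gamma)$, the hereditary graph class $\mathcal{G}^{\delta}$ has unbounded clique-width if and only if $\mathcal{N}^{\delta}$ is unbounded.
   Context: $\mathbb{N}=\{1,2,\dots\}$; all graphs are simple and undirected. A bond-set $\beta$ is a symmetric subset of $\{(x,y)\in\mathbb{N}^2: |x-y|>1\}$. A $\delta$-triple $\delta=(\alpha,\beta,\gamma)$ consists of an infinite word $\alpha=\alpha_1\alpha_2\cdots$ over the alphabet $\{0,1,2,3\}$, a bond-set $\beta$, and an infinite binary word $\gamma=\gamma_1\gamma_2\cdots$. The infinite graph $\mathcal{P}^{\delta}$ has vertex set $\{v_{i,j}: i,j\in\mathbb{N}\}$, where $v_{i,j}$ is in column $i$ and row $j$; $C_i=\{v_{i,j}:j\in\mathbb{N}\}$. Its edges are the following. (a) Between $C_i$ and $C_{i+1}$, for each $i\ge 1$: $v_{i,j}\sim v_{i+1,k}$ iff $j=k$ when $\alpha_i=0$; iff $j\ne k$ when $\alpha_i=1$; iff $j\ge k$ when $\alpha_i=2$; iff $j<k$ when $\alpha_i=3$. (b) Between $C_i$ and $C_j$ with $|i-j|>1$: all edges if $(i,j)\in\beta$, and none otherwise. (c) Within $C_i$: all edges if $\gamma_i=1$ (a clique), none if $\gamma_i=0$ (an independent set). $\mathcal{G}^{\delta}$ is the class of all finite induced subgraphs of $\mathcal{P}^{\delta}$. For a graph $G=(V,E)$ and $U\subseteq V$, two vertices of $U$ are $V\setminus U$-similar if they have the same neighbourhood in $V\setminus U$; $\mu(G,U)$ is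 the number of equivalence classes of this relation on $U$. For finite $Q\subseteq\mathbb{N}$ let $R_1(Q)=\{v_{i,1}:i\in Q\}$ and $R_2(Q)=\{v_{i,2}:i\in Q\}$, let the two-row graph $T^{\delta}(Q)$ be the subgraph of $\mathcal{P}^{\delta}$ induced on $R_1(Q)\cup R_2(Q)$, and let $\mathcal{N}^{\delta}(Q)=\mu(T^{\delta}(Q),R_1(Q))$. We say $\mathcal{N}^{\delta}$ is unbounded if, for some fixed $j\in\mathbb{N}$, $\mathcal{N}^{\delta}([j,n])$ is unbounded as $n\to\infty$, where $[j,n]=\{j,j+1,\dots,n\}$. The clique-width of a graph $G$ is the minimum number of labels needed to construct $G$ using: creation of a vertex with a label $i$; adding all edges between vertices labelled $i$ and vertices labelled $j$ ($i\ne j$); relabelling all vertices labelled $i$ to $j$; and disjoint union of two previously constructed labelled graphs. A class has unbounded clique-width if there is no upper bound on the clique-width of its members. *)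

(* Defs.v *)
From HB Require Import structures.
From mathcomp Require Import all_boot finmap.

Set Implicit Arguments.
Unset Strict Implicit.
Unset Printing Implicit Defensive.

(* The positive integers 1, 2, ... indexing columns, rows and letters are
   represented by nat through n |-> n - 1: the vertex v_{i,j} is the pair
   (i - 1, j - 1), so that rows 1 and 2 are rows 0 and 1 below, and alpha_i is
   [alpha (i - 1)].  Every condition in the definitions only compares indices
   or takes successors, hence is invariant under this shift. *)

Record sgraph (V : Type) := SGraph {
  edge :> rel V;
  edge_sym : symmetric edge;
  edge_irr : irreflexive edge }.

Definition isomorphic (V W : Type) (e : rel V) (e' : rel W) : Prop :=
  exists2 f : V -> W, bijective f & forall x y, e' (f x) (f y) = e x y.

Section Induced.
Variables (V : choiceType) (G : sgraph V) (U : {fset V}).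

Definition induced_edge : rel U := fun x y => G (val x) (val y).

Fact induced_sym : symmetric induced_edge.
Proof. by move=> x y; apply: edge_sym. Qed.

Fact induced_irr : irreflexive induced_edge.
Proof. by move=> x; apply: edge_irr. Qed.

Definition induced : sgraph U := SGraph induced_sym induced_irr.
End Induced.

Record delta_triple := DeltaTriple {
  alpha : nat -> 'I_4;
  beta : rel nat;
  gamma : nat -> bool;
  beta_sym : symmetric beta;
  beta_far : forall x y, beta x y -> (x.+1 < y) || (y.+1 < x) }.

Definition letter_adj (a : 'I_4) (j k : nat) : bool :=
  match val a with
  | 0 => j == k
  | 1 => j != k
  | 2 => j >= k
  | _ => j < k
  end.

Definition P_edge (delta : delta_triple) : rel (nat * nat) := fun u v =>
  if u.1 == v.1 then gamma delta u.1 && (u.2 != v.2)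
  else if v.1 == u.1.+1 then letter_adj (alpha delta u.1) u.2 v.2
  else if u.1 == v.1.+1 then letter_adj (alpha delta v.1) v.2 u.2
  else beta delta u.1 v.1.

Fact P_sym delta : symmetric (P_edge delta).
Proof.
move=> [i j] [i' k]; rewrite /P_edge /= [i' == i]eq_sym.
case: eqP => [->|_]; first by rewrite [k == j]eq_sym.
have [->|_] := eqVneq i' i.+1; first by rewrite -[i == _]negbK neq_ltn ltnS leqW.
by case: eqP => // _; apply: beta_sym.
Qed.

Fact P_irr delta : irreflexive (P_edge delta).
Proof. by move=> u; rewrite /P_edge !eqxx andbF. Qed.

Definition P (delta : delta_triple) : sgraph (nat * nat) :=
  SGraph (@P_sym delta) (@P_irr delta).

Definition graph_class := forall V : finType, sgraph V -> Prop.

Definition G_class (delta : delta_triple) : graph_class := fun V G =>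
  exists U : {fset nat * nat}, isomorphic G (induced (P delta) U).

Section Similarity.
Variables (V : finType) (G : sgraph V) (U : {set V}).

Definition similar : rel V := fun x y => [forall z in ~: U, G x z == G y z].

Definition mu : nat := #|equivalence_partition similar U|.
End Similarity.

Definition row (j : nat) (Q : {fset nat}) : {fset nat * nat} :=
  [fset (i, j) | i in Q]%fset.

Definition R1 := row 0.
Definition R2 := row 1.

Definition two_row (delta : delta_triple) (Q : {fset nat}) :
    sgraph (R1 Q `|` R2 Q)%fset :=
  induced (P delta) (R1 Q `|` R2 Q)%fset.

Definition N_param (delta : delta_triple) (Q : {fset nat}) : nat :=
  mu (two_row delta Q) [set x | val x \in R1 Q].

Definition interval (j n : nat) : {fset nat} :=
  [fset i in iota j (n.+1 - j)]%fset.

Definition N_unbounded (delta : delta_triple) : Prop :=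
  exists j, forall b, exists2 n, j <= n & b < N_param delta (interval j n).

Inductive cw_expr (k : nat) : Type :=
| CwVertex of 'I_k
| CwJoin (i j : 'I_k) of i != j & cw_expr k
| CwRelabel of 'I_k & 'I_k & cw_expr k
| CwUnion of cw_expr k & cw_expr k.

Section Evaluation.
Variable k : nat.

Fixpoint cw_verts (t : cw_expr k) : finType :=
  match t with
  | CwVertex _ => unit
  | CwJoin _ _ _ t1 => cw_verts t1
  | CwRelabel _ _ t1 => cw_verts t1
  | CwUnion t1 t2 => (cw_verts t1 + cw_verts t2)%type
  end.

Fixpoint cw_label (t : cw_expr k) : cw_verts t -> 'I_k :=
  match t return cw_verts t -> 'I_k with
  | CwVertex i => fun _ => i
  | CwJoin _ _ _ t1 => @cw_label t1
  | CwRelabel i j t1 => fun x =>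
      if @cw_label t1 x == i then j else @cw_label t1 x
  | CwUnion t1 t2 => fun x =>
      match x with inl x1 => @cw_label t1 x1 | inr x2 => @cw_label t2 x2 end
  end.

Fixpoint cw_edge (t : cw_expr k) : rel (cw_verts t) :=
  match t return rel (cw_verts t) with
  | CwVertex _ => fun _ _ => false
  | CwJoin i j _ t1 => fun x y =>
      [|| @cw_edge t1 x y,
          (@cw_label t1 x == i) && (@cw_label t1 y == j) |
          (@cw_label t1 x == j) && (@cw_label t1 y == i)]
  | CwRelabel _ _ t1 => @cw_edge t1
  | CwUnion t1 t2 => fun x y =>
      match x, y with
      | inl x1, inl y1 => @cw_edge t1 x1 y1
      | inr x2, inr y2 => @cw_edge t2 x2 y2
      | _, _ => false
      end
  end.
End Evaluation.

Definition constructible (V : finType) (G : sgraph V) (k : nat) : Prop :=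
  exists t : cw_expr k, isomorphic (@cw_edge k t) G.

(* A relation rather than a function: the operations cannot build the graph
   with no vertex, which is thus assigned no clique-width (and so does not
   affect whether a class is bounded). *)
Definition clique_width (V : finType) (G : sgraph V) (k : nat) : Prop :=
  constructible G k /\ forall m, constructible G m -> k <= m.

Definition unbounded_clique_width (C : graph_class) : Prop :=
  ~ exists b, forall (V : finType) (G : sgraph V) k,
      C V G -> clique_width G k -> k <= b.

(* Main.v *)
Require Import Defs.
From mathcomp Require Import all_boot finmap.
From mathcomp Require Import zify.
From Stdlib Require Import Classical.

(** Whether two vertices in different rows are adjacent depends only on their
    columns and on which of the two rows is lower: it is read off the 0-1
    matrix [cross], whose entry at (i, i') says whether v_{i,1} and v_{i',2}
    are adjacent.  The number N(Q) counts the distinct rows of the submatrix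
    of [cross] indexed by Q ([N_param_le_card], [N_param_labelling]).

    If N(Q) <= b on all initial intervals Q, a finite induced subgraph is built
    one vertex at a time, row by row and from left to right in each row.  Call
    two columns equivalent if their rows of [cross] agree.  When a vertex x is
    added, an earlier vertex lies either in a lower row, or in the row of x at
    least two columns away, or is the left neighbour of x in its row.  In the
    first two cases its adjacency to x is an entry of [cross], hence is known
    from its column class; in the third it is the vertex added just before x.
    So the classes, one label for the vertex added last and one for x suffice
    ([constructible_caterpillar], [constructible_of_N_bounded]).

    Conversely, an expression with k labels has a subexpression whose vertex
    set U takes a moderate share of any prescribed set A; vertices of U with
    equal labels there have the same neighbours outside U, so mu(G, U) <= k
    ([constructible_cut]).  Apply this to the grid of the columns [j, n] and a
    large number M of rows, with A the first column.  A row which is neither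
    inside nor outside U switches somewhere between two consecutive columns;
    for each letter, rows switching at the same place in the same direction
    have pairwise dissimilar vertices in U, so at most k of them exist, and
    the number of such rows is bounded independently of M ([card_mixed]).  As
    A is split fairly, one row lies inside U and another one outside.  The
    matrix [cross] on [j, n] is the adjacency between these two rows, so it has
    either at most k distinct rows or at most k distinct columns, and in both
    cases N([j, n]) <= 2 ^ k ([N_param_pure_rows]). *)

Set Implicit Arguments.
Unset Strict Implicit.
Unset Printing Implicit Defensive.

(** * Labellings and the similarity number *)

Section Mu.
Variables (V : finType) (G : sgraph V) (U : {set V}).

Lemma similarP x y :
  reflect (forall z, z \notin U -> G x z = G y z) (similar G U x y).
Proof.
apply: (iffP forall_inP) => [h z zU|h z]; first by apply/eqP/h; rewrite inE.
by rewrite inE => /h ->.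
Qed.

Lemma similar_equiv x y : similar G U x y -> similar G U x =1 similar G U y.
Proof.
move/similarP=> xy z.
by apply/similarP/similarP => h w wU; [rewrite -xy ?h | rewrite xy ?h].
Qed.

Lemma mu_le_card (T : finType) (phi : V -> T) :
  {in U &, forall x y, phi x = phi y -> similar G U x y} -> mu G U <= #|T|.
Proof.
move=> phi_sim; rewrite /mu /equivalence_partition.
set F := fun x => [set y in U | similar G U x y].
(* h inverts phi up to similarity: it sends a label to the class it names. *)
pose h c := odflt set0 (omap F [pick x in U | phi x == c]).
apply: leq_trans (_ : #|h @: T| <= _); last exact: leq_imset_card.
apply/subset_leq_card/subsetP => X /imsetP[x xU ->]; apply/imsetP.
exists (phi x) => //; rewrite /h.
case: pickP => [y /andP[yU /eqP e]|/(_ x)]; last by rewrite xU eqxx.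
apply/setP => z; rewrite !inE; congr andb.
by apply: similar_equiv; apply: phi_sim.
Qed.

(** Together with the previous lemma, this makes mu <= k equivalent, for k > 0,
    to the existence of a k-labelling of U refining similarity; all later
    arguments handle such labellings instead of partitions. *)
Lemma mu_labelling k : 0 < k -> mu G U <= k ->
  exists phi : V -> 'I_k,
    {in U &, forall x y, phi x = phi y -> similar G U x y}.
Proof.
case: k => // k _; rewrite /mu /equivalence_partition.
set F := fun x => [set y in U | similar G U x y]; move=> le_k.
exists (fun x => inord (index (F x) (enum (F @: U)))).
move=> x y xU yU /(congr1 val).
have FU z : z \in U -> F z \in enum (F @: U).
  by move=> zU; rewrite mem_enum imset_f.
have bnd z : z \in U -> index (F z) (enum (F @: U)) < k.+1.
  by move=> zU; apply: leq_trans le_k; rewrite cardE index_mem FU.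
rewrite /= !inordK ?bnd //.
move/(congr1 (nth set0 (enum (F @: U)))); rewrite !nth_index ?FU //.
by move/setP/(_ y); rewrite !inE yU /= => ->; apply/similarP.
Qed.
End Mu.

(** * Balanced cuts of a clique-width expression *)

Lemma card_sum_set (S T : finType) (B : {set S + T}) :
  #|B| = #|inl @^-1: B| + #|inr @^-1: B|.
Proof.
rewrite -!sum1_card big_sumType /=.
by congr addn; apply: eq_bigl => x; rewrite inE.
Qed.

Section Cut.
Variables (k w : nat).

(** The requirement on [cw_label] is what makes the second condition survive
    the operations applied above the subexpression: they treat vertices with
    the same current label alike. *)
Definition balanced_cut (t : cw_expr k) (A U : {set cw_verts t})
    (l : cw_verts t -> 'I_k) :=
  w <= #|A :&: U| < w.*2 /\
  {in U &, forall x y, l x = l y -> cw_label x = cw_label y /\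
     forall z, z \notin U -> cw_edge x z = cw_edge y z}.

(** U is the vertex set of a subexpression, reached from the root by keeping at
    least w vertices of A until fewer than 2w of them are left: a disjoint
    union with at least 2w of them has a part with at least w. *)
Lemma cw_expr_cut (t : cw_expr k) (A : {set cw_verts t}) :
    0 < w -> w <= #|A| ->
  exists U : {set cw_verts t}, exists l, balanced_cut A U l.
Proof.
move=> w0.
have whole (t' : cw_expr k) (B : {set cw_verts t'}) :
    w <= #|B| -> #|B| < w.*2 -> exists U, exists l, balanced_cut B U l.
  move=> wB small; exists setT, (@cw_label k t').
  rewrite /balanced_cut setIT wB; split=> // x y _ _ e.
  by split=> // z; rewrite inE.
elim: t A => [i|i j ij t IH|i j t IH|t1 IH1 t2 IH2] A wA;
  (have [small|big] := ltnP #|A| w.*2; first exact: whole).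
- have := leq_trans big (max_card A); rewrite card_unit; lia.
- have [U [l [bal sim]]] := IH A wA; exists U, l; split=> // x y xU yU e.
  have [lab adj] := sim x y xU yU e; split=> // z zU /=.
  by rewrite lab adj.
- have [U [l [bal sim]]] := IH A wA; exists U, l; split=> // x y xU yU e.
  by have [lab adj] := sim x y xU yU e; split=> //=; rewrite lab.
have [A1|A1] := leqP w #|inl @^-1: A|.
  have [U [l [bal sim]]] := IH1 _ A1.
  exists [set x | if x is inl x1 then x1 \in U else false].
  exists (fun x => match x with inl x1 => l x1 | inr x2 => cw_label x2 end).
  split.
    rewrite card_sum_set (eq_card0 (A := inr @^-1: _)) => [|x].
      rewrite addn0 (eq_card (B := inl @^-1: A :&: U)) // => x.
      by rewrite !inE.
    by rewrite !inE /= andbF.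
  move=> [x|x] [y|y]; rewrite !inE //= => xU yU e.
  have [lab adj] := sim x y xU yU e; split=> // -[z|z]; rewrite inE //=.
  exact: adj.
have [|U [l [bal sim]]] := IH2 (inr @^-1: A).
  move: big; rewrite card_sum_set -addnn leqNgt; apply: contraNT.
  by rewrite -ltnNge => A2; rewrite -addSn leq_add // ltnW.
exists [set x | if x is inr x1 then x1 \in U else false].
exists (fun x => match x with inl x1 => cw_label x1 | inr x2 => l x2 end).
split.
  rewrite card_sum_set (eq_card0 (A := inl @^-1: _)) => [|x].
    by rewrite (eq_card (B := inr @^-1: A :&: U)) // => x; rewrite !inE.
  by rewrite !inE /= andbF.
move=> [x|x] [y|y]; rewrite !inE //= => xU yU e.
have [lab adj] := sim x y xU yU e; split=> // -[z|z]; rewrite inE //=.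
exact: adj.
Qed.
End Cut.

Lemma constructible_cut (V : finType) (G : sgraph V) k w (A : {set V}) :
    constructible G k -> 0 < w -> w <= #|A| ->
  exists2 U : {set V}, w <= #|A :&: U| < w.*2 & mu G U <= k.
Proof.
move=> [t [g [g' gK g'K] gE]] w0 wA.
have [|U [l [bal sim]]] := @cw_expr_cut k w t (g @^-1: A) w0.
  by rewrite on_card_preimset //; exists g' => x _.
exists (g' @^-1: U).
  rewrite (_ : A :&: _ = g' @^-1: ((g @^-1: A) :&: U)).
    by rewrite on_card_preimset //; exists g => x _.
  by apply/setP => x; rewrite !inE g'K.
rewrite -[leqRHS]card_ord; apply: (mu_le_card (phi := l \o g')) => x y.
rewrite !inE => xU yU /(sim _ _ xU yU)[_ adj]; apply/similarP => z.
by rewrite inE => /adj; rewrite -!gE !g'K.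
Qed.

(** * Adjacency between rows and the two-row graph *)

Definition cross delta i i' := P_edge delta (i, 0) (i', 1).

(** Every adjacency rule only compares the two row indices. *)
Lemma P_edge_ltn_row delta i i' j j' :
  j < j' -> P_edge delta (i, j) (i', j') = cross delta i i'.
Proof.
move=> lt; rewrite /cross /P_edge /letter_adj /=.
case: (i == i'); first by rewrite (ltn_eqF lt).
by do 2?case: ifP => _ //; case: (val _) => [|[|[|?]]]; lia.
Qed.

Lemma P_edge_far delta i i' j :
  i.+1 < i' -> P_edge delta (i, j) (i', j) = cross delta i i'.
Proof. by move=> lt; rewrite /cross /P_edge /= !ifN_eq //; lia. Qed.

Lemma P_edge_next delta i j j' :
  P_edge delta (i, j) (i.+1, j') = letter_adj (alpha delta i) j j'.
Proof. by rewrite /P_edge /= eqxx ifN_eq //; lia. Qed.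

(** Between consecutive columns, each of the four letters makes two rows
    distinguishable by the neighbours within these two rows alone.  In this
    lemma the distinguished vertices are in the left column; in the next one,
    in the right column. *)
Lemma letter_adj_separates_left a j j' :
    letter_adj a j j = letter_adj a j' j ->
  letter_adj a j j' = letter_adj a j' j' -> j = j'.
Proof. by rewrite /letter_adj; case: (val a) => [|[|[|?]]]; lia. Qed.

Lemma letter_adj_separates_right a j j' :
    letter_adj a j j = letter_adj a j j' ->
  letter_adj a j' j = letter_adj a j' j' -> j = j'.
Proof. by rewrite /letter_adj; case: (val a) => [|[|[|?]]]; lia. Qed.

Lemma in_row (j : nat) (Q : {fset nat}) i j' :
  ((i, j') \in row j Q) = (i \in Q) && (j' == j).
Proof.
apply/imfsetP/andP => [[i' iQ [-> ->]]|[iQ /eqP->]]; first by split.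
by exists i.
Qed.

Lemma in_interval j n i : (i \in interval j n) = (j <= i <= n).
Proof. by rewrite in_fset /= mem_iota; lia. Qed.

Lemma N_param_le_card delta (Q : {fset nat}) (T : finType) (phi : nat -> T) :
    (forall i i', i \in Q -> i' \in Q -> phi i = phi i' ->
       {in Q, cross delta i =1 cross delta i'}) ->
  N_param delta Q <= #|T|.
Proof.
move=> phi_cross; apply: (mu_le_card (phi := fun u => phi (val u).1)).
move=> [[i j] u] [[i' j'] v].
rewrite !inE /= !in_row => /andP[iQ /eqP j0] /andP[iQ' /eqP j0'] e; subst j j'.
apply/similarP => -[[i'' j'' /= w]]; rewrite !inE /= /induced_edge /=.
have := w; rewrite !inE !in_row => /orP[->//|/andP[wQ /eqP j1]] _; subst j''.
exact: phi_cross.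
Qed.

Lemma N_param_labelling delta (Q : {fset nat}) k :
    0 < k -> N_param delta Q <= k ->
  exists phi : nat -> 'I_k,
    forall i i', i \in Q -> i' \in Q -> phi i = phi i' ->
      {in Q, cross delta i =1 cross delta i'}.
Proof.
case: k => // k _ /(mu_labelling (ltn0Sn k))[l l_sim].
(* The default ord0 is only used for columns outside Q. *)
exists (fun i => odflt ord0 (omap l (insub (i, 0)))) => i i' iQ iQ'.
have R i0 : i0 \in Q -> (i0, 0) \in (R1 Q `|` R2 Q)%fset.
  by rewrite !inE !in_row eqxx => ->.
rewrite !(insubT (mem _) (R _ _)) /= => e z zQ.
have zR : (z, 1) \in (R1 Q `|` R2 Q)%fset by rewrite !inE !in_row zQ orbT.
have /similarP/(_ [` zR]%fset) :
    similar (two_row delta Q) [set x | val x \in R1 Q]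
      [` R i iQ]%fset [` R i' iQ']%fset.
  by apply: l_sim e; rewrite inE /= in_row ?iQ ?iQ'.
by apply; rewrite inE /= in_row andbF.
Qed.

(** * Unbounded N forces unbounded clique-width *)

Section Pullback.
Variables (delta : delta_triple) (V : finType) (f : V -> nat * nat).

Definition pullback_edge : rel V := fun x y => P delta (f x) (f y).

Fact pullback_sym : symmetric pullback_edge.
Proof. by move=> x y; apply: edge_sym. Qed.

Fact pullback_irr : irreflexive pullback_edge.
Proof. by move=> x; apply: edge_irr. Qed.

(** Naming the vertices of a member of the class by a convenient finite type
    avoids the subtype attached to a finite set of pairs. *)
Definition pullback := SGraph pullback_sym pullback_irr.

Lemma G_class_pullback : injective f -> G_class delta pullback.
Proof.
move=> f_inj; exists [fset f x | x in V]%fset.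
have fV x : f x \in [fset f x | x in V]%fset by apply/imfsetP; exists x.
exists (fun x => [` fV x]%fset) => //; apply: inj_card_bij.
  by move=> x y /(congr1 val) /f_inj.
by rewrite -cardfE card_imfset //= -cardE.
Qed.
End Pullback.

Section Grid.
Variables (delta : delta_triple) (j s M : nat).

Definition cell : finType := ('I_s.+1 * 'I_M)%type.

Definition cell_pos (x : cell) : nat * nat := (j + x.1, val x.2).

Lemma cell_pos_inj : injective cell_pos.
Proof.
by move=> [c r] [c' r'] [/addnI e e']; congr pair; apply: val_inj.
Qed.

Definition grid := pullback delta cell_pos.

Variables (k : nat) (U : {set cell}).
Hypotheses (k0 : 0 < k) (mu_k : mu grid U <= k).

Definition mixed : {set 'I_M} :=
  [set r | [exists c, ((c, r) \in U) != ((ord0, r) \in U)]].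

(** Along a mixed row, membership in U must change between two consecutive
    columns. *)
Lemma mixed_switch r : r \in mixed ->
  exists2 c : 'I_s.+1, c < s & ((c, r) \in U) != ((inord c.+1, r) \in U).
Proof.
rewrite inE => /existsP[c ne]; apply: NNPP => no_switch.
case/negP: ne; apply/eqP.
elim: {c}(val c) {-2}c (erefl (val c)) => [|m IH] c cm.
  by rewrite (_ : c = ord0) //; apply: val_inj.
have lt_m : m < s by rewrite -ltnS -cm; apply: ltn_ord.
have vm : (inord m : 'I_s.+1) = m :> nat by rewrite inordK // ltnW.
rewrite -(IH (inord m)) //; apply/esym/eqP/negPn/negP => ne.
case: no_switch; exists (inord m); rewrite vm //.
by rewrite (_ : inord m.+1 = c) //; apply: val_inj; rewrite /= inordK ?ltnS.
Qed.

(** A mixed row is determined by a column where it switches, the direction of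
    the switch, and the label of its vertex of U at the switch: two rows with
    the same first two data face each other across the cut between two
    consecutive columns, where each letter separates them. *)
Lemma card_mixed : #|mixed| <= s.+1 * 2 * k.
Proof.
have [l l_sim] := mu_labelling k0 mu_k.
pose sw r := odflt ord0 [pick c : 'I_s.+1 | (c < s) &&
   (((c, r) \in U) != ((inord c.+1, r) \in U))].
have swP r : r \in mixed ->
    sw r < s /\ ((sw r, r) \in U) != ((inord (sw r).+1, r) \in U).
  move=> /mixed_switch[c cs sc]; rewrite /sw.
  by case: pickP => [c' /andP[]|/(_ c)]; rewrite ?cs ?sc.
pose blue r := if (sw r, r) \in U then (sw r, r) else (inord (sw r).+1, r).
pose code r := (sw r, (sw r, r) \in U, l (blue r)).
suff code_inj : {in mixed &, injective code}.
  rewrite -(card_in_imset code_inj); apply: leq_trans (max_card _) _.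
  by rewrite !card_prod card_bool !card_ord.
move=> r r' rM r'M [].
have [lt_s] := swP r rM; have [_] := swP r' r'M; rewrite /blue => + + e.
rewrite -e {e}.
have [rU|rU] := boolP ((sw r, r) \in U);
  have [r'U|r'U] := boolP ((sw r, r') \in U) => //= nr' nr _ /l_sim sim.
  have /similarP {}sim := sim rU r'U.
  apply/val_inj/(@letter_adj_separates_left (alpha delta (j + sw r))).
    have := sim _ nr; rewrite /= /pullback_edge /cell_pos /= inordK // addnS.
    by rewrite !P_edge_next.
  have := sim _ nr'; rewrite /= /pullback_edge /cell_pos /= inordK // addnS.
  by rewrite !P_edge_next.
move: nr nr'; rewrite !negbK => nr nr'.
have /similarP {}sim := sim nr nr'.
apply/val_inj/(@letter_adj_separates_right (alpha delta (j + sw r))).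
  have := sim _ rU; rewrite /= /pullback_edge /cell_pos /= inordK // addnS.
  by rewrite !(P_sym delta (_.+1, _)) !P_edge_next.
have := sim _ r'U; rewrite /= /pullback_edge /cell_pos /= inordK // addnS.
by rewrite !(P_sym delta (_.+1, _)) !P_edge_next.
Qed.

Lemma pure_row (o : bool) :
    s.+1 * 2 * k < #|[set r | ((ord0, r) \in U) == o]| ->
  exists r, forall c, ((c, r) \in U) = o.
Proof.
move=> many.
have /subsetPn[r] : ~~ ([set r | ((ord0, r) \in U) == o] \subset mixed).
  apply: contraL many => sub; rewrite -leqNgt.
  exact: leq_trans (subset_leq_card sub) card_mixed.
rewrite !inE => /eqP <- /existsPn pure; exists r => c.
by apply/eqP/negPn; apply: pure.
Qed.

(** The k-labelling of the row inside U bounds the number of distinct rows of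
    [cross] by k if that row is the lower one.  Otherwise it bounds the number
    of distinct columns by k, and a row is then determined by the set of labels
    of the columns in which it has an entry 1; this is where the exponential
    comes from. *)
Lemma N_param_pure_rows r r' :
    (forall c, (c, r) \in U) -> (forall c, (c, r') \notin U) ->
  N_param delta (interval j (j + s)) <= 2 ^ k.
Proof.
move=> blue red; have [l l_sim] := mu_labelling k0 mu_k.
have colK i : i \in interval j (j + s) -> j + inord (n' := s) (i - j) = i.
  by rewrite in_interval => iQ; rewrite inordK; lia.
have [lt|lt|e] := ltngtP r r'; last first.
- by have := red ord0; rewrite (_ : r' = r) ?blue //; apply: val_inj.
- rewrite -[X in 2 ^ X]card_ord -cardsT -card_powerset powersetT cardsT.
  pose phi i := [set a | [exists c, (l (c, r) == a) && cross delta i (j + c)]].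
  have phiE i (c : 'I_s.+1) : i \in interval j (j + s) ->
      (l (c, r) \in phi i) = cross delta i (j + c).
    move=> iQ; rewrite inE; apply/existsP/idP => [[c' /andP[/eqP e]]|ic].
      have /similarP sim := l_sim _ _ (blue _) (blue _) e.
      have := sim _ (red (inord (i - j))).
      rewrite /= /pullback_edge /cell_pos /= colK // !(P_sym delta (_, val r)).
      by rewrite !P_edge_ltn_row // => ->.
    by exists c; rewrite eqxx.
  apply: (N_param_le_card (phi := phi)) => i i' iQ i'Q e z zQ.
  by rewrite -(colK z zQ) -!phiE // e.
apply: leq_trans (ltnW (ltn_expl k (ltnSn 1))); rewrite -[leqRHS]card_ord.
apply: (N_param_le_card (phi := fun i => l (inord (i - j), r))).
move=> i i' iQ i'Q /(l_sim _ _ (blue _) (blue _))/similarP sim z zQ.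
have := sim _ (red (inord (z - j))).
by rewrite /= /pullback_edge /cell_pos /= !colK // !P_edge_ltn_row.
Qed.
End Grid.

(** The empty member of the class is excluded because no expression builds
    it. *)
Lemma N_bounded_of_clique_width delta b j n : j <= n ->
    (forall (V : finType) (G : sgraph V), G_class delta G -> V ->
       exists2 k, k <= b & constructible G k) ->
  N_param delta (interval j n) <= 2 ^ b.+1.
Proof.
(* w exceeds the bound on mixed rows, and M = 3w: a cut that meets the first
   column in less than 2w vertices leaves more than w of its vertices out. *)
move=> jn small; pose s := n - j; pose w := (s.+1 * 2 * b.+1).+1.
pose M := w + w.*2.
have M0 : 0 < M by [].
have [|k kb kG] := small _ (grid delta j s M) _ (ord0, Ordinal M0).
  exact/G_class_pullback/cell_pos_inj.
pose A : {set cell s M} := [set x | x.1 == ord0].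
have cardA (B : {set cell s M}) : #|A :&: B| = #|[set r | (ord0, r) \in B]|.
  rewrite -(card_imset _ (f := fun r => (ord0, r) : cell s M)).
    apply: eq_card => -[c r]; rewrite !inE /=.
    apply/andP/imsetP => [[/eqP -> rB]|[r' + [-> ->]]].
      by exists r; rewrite ?inE.
    by rewrite inE.
  by move=> ? ? [].
have AM : #|A| = M.
  rewrite -(setIT A) cardA -[RHS]card_ord; apply: eq_card => r.
  by rewrite !inE.
have [//|/=|U /andP[wU Uw] muU] := constructible_cut (w := w) (A := A) kG.
  by rewrite AM leq_addr.
have muU' := leq_trans muU (leqW kb).
have [|r blue] := pure_row (o := true) (ltn0Sn b) muU'.
  move: wU; rewrite cardA => /leq_trans; apply.
  by apply/subset_leq_card/subsetP => i; rewrite !inE => ->.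
have [|r' red] := pure_row (o := false) (ltn0Sn b) muU'.
  rewrite (_ : [set r | _] = ~: [set r | (ord0, r) \in U]).
    have := cardsC [set r | (ord0, r) \in U]; rewrite card_ord -cardA /M => e.
    by rewrite -/w -(leq_add2l #|A :&: U|) e addnC leq_add2l ltnW.
  by apply/setP => i; rewrite !inE eqbF_neg.
rewrite -(subnKC jn).
apply: (N_param_pure_rows (r := r) (r' := r') (ltn0Sn b) muU').
  by move=> c; rewrite blue.
by move=> c; rewrite red.
Qed.

(** * Building a graph one vertex at a time *)

Section Built.
Variables (V : eqType) (k : nat).
Implicit Types (s : seq V) (E : rel V) (L : V -> 'I_k).

(** The vertex type of an expression depends on the expression; naming its
    vertices in a fixed type V allows the operations to be composed without
    transporting along equalities of types.  E and L only matter on s. *)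
Definition built s E L := exists t : cw_expr k, exists f : cw_verts t -> V,
  [/\ injective f, forall v, v \in s <-> exists x, f x = v,
      forall x y, cw_edge x y = E (f x) (f y) &
      forall x, cw_label x = L (f x)].

Lemma built_ext s s' E E' L L' :
    s =i s' -> {in s &, E =2 E'} -> {in s, L =1 L'} ->
  built s E L -> built s' E' L'.
Proof.
move=> es eE eL [t [f [fI fs fE fL]]]; exists t, f.
have fin x : f x \in s by apply/fs; exists x.
split=> // [v|x y|x]; last by rewrite fL eL.
  by rewrite -es.
by rewrite fE eE.
Qed.

Lemma built_vertex v E L : E v v = false -> built [:: v] E L.
Proof.
move=> Ev; exists (CwVertex (L v)), (fun=> v); split=> //= [[] []//|u].
by rewrite inE; split=> [/eqP->|[_ ->]]; first by exists tt.
Qed.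

Lemma built_join s E L i j : i != j -> built s E L ->
  built s (fun x y => [|| E x y, (L x == i) && (L y == j)
                             | (L x == j) && (L y == i)]) L.
Proof.
move=> ij [t [f [fI fs fE fL]]]; exists (CwJoin ij t), f; split=> //= x y.
by rewrite fE !fL.
Qed.

Lemma built_relabel s E L i j : built s E L ->
  built s E (fun x => if L x == i then j else L x).
Proof.
move=> [t [f [fI fs fE fL]]]; exists (CwRelabel i j t), f; split=> //= x.
by rewrite !fL.
Qed.

Lemma built_union s1 s2 E L :
    {in s1 & s2, forall x y, ~~ E x y && ~~ E y x} ->
    {in s1, forall x, x \notin s2} -> built s1 E L -> built s2 E L ->
  built (s1 ++ s2) E L.
Proof.
move=> noE dis [t1 [f1 [f1I f1s f1E f1L]]] [t2 [f2 [f2I f2s f2E f2L]]].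
have in1 x : f1 x \in s1 by apply/f1s; exists x.
have in2 x : f2 x \in s2 by apply/f2s; exists x.
exists (CwUnion t1 t2).
exists (fun x => match x with inl x1 => f1 x1 | inr x2 => f2 x2 end).
split=> [[x|x] [y|y]|v|[x|x] [y|y]|[x|x]] //=.
- by move/f1I->.
- by move=> e; have := dis _ (in1 x); rewrite e in2.
- by move=> e; have := dis _ (in1 y); rewrite -e in2.
- by move/f2I->.
- rewrite mem_cat; split=> [/orP[/f1s[x]|/f2s[x]]|[[x|x] <-]].
  + by exists (inl x).
  + by exists (inr x).
  + by rewrite in1.
  + by rewrite in2 orbT.
- by have /andP[/negPf] := noE _ _ (in1 x) (in2 y).
- by have /andP[_ /negPf] := noE _ _ (in1 y) (in2 x).
Qed.

Lemma built_joins s E L (D : pred 'I_k) i : ~~ D i -> built s E L ->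
  built s (fun x y =>
    [|| E x y, D (L x) && (L y == i) | (L x == i) && D (L y)]) L.
Proof.
move=> Di Es.
suff ds (r : seq 'I_k) : i \notin r ->
    built s (fun x y =>
      [|| E x y, (L x \in r) && (L y == i) | (L x == i) && (L y \in r)]) L.
  have := ds (enum D); rewrite mem_enum => /(_ Di).
  by apply: built_ext => // x y _ _; rewrite !mem_enum.
elim: r => [_|a r IH].
  by apply: built_ext Es => // x y _ _; rewrite !in_nil /= andbF orbF.
rewrite inE negb_or eq_sym => /andP[ai ir].
apply: built_ext (built_join ai (IH ir)) => // x y _ _; rewrite !inE.
case: (E x y) => //=; case: (L x == a); case: (L x == i);
  by case: (L x \in r); case: (L y == a); case: (L y == i); case: (L y \in r).
Qed.
End Built.

(** In a vertex order such that the adjacency of a new vertex to every earlier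
    vertex but the latest one is determined by a b-labelling c of the latter,
    two further labels suffice: one for the latest vertex, one for the new
    one. *)
Section Caterpillar.
Variables (V : finType) (G : sgraph V) (b : nat) (c : V -> 'I_b).
Variable s : seq V.
Hypothesis s_uniq : uniq s.
Hypothesis c_adj : forall p y x q, s = p ++ y :: x :: q ->
  {in p &, forall z z', c z = c z' -> G z x = G z' x}.

Let cls z : 'I_(b + 2) := lshift 2 (c z).
Let last_lab : 'I_(b + 2) := rshift b ord0.
Let new_lab : 'I_(b + 2) := rshift b ord_max.

Lemma built_prefix p y q : s = p ++ y :: q ->
  built (rcons p y) G (fun z => if z == y then last_lab else cls z).
Proof.
elim/last_ind: p y q => [|p y IH] x q es.
  exact/built_vertex/edge_irr.
rewrite cat_rcons in es.
have := IH _ _ es; set L := fun z => _; set S := rcons p y => Sb.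
have xS : x \notin S.
  move: s_uniq; rewrite es -cat_rcons cat_uniq /= negb_or -/S.
  by case/and3P=> _ /andP[].
pose E1 z w := [&& G z w, z != x & w != x].
pose L1 z := if z == x then new_lab else L z.
have nx z : z \in S -> z == x = false.
  by move=> zS; apply: contraNF xS => /eqP <-.
have S1 : built (S ++ [:: x]) E1 L1.
  apply: built_union.
  - by move=> z w zS; rewrite inE => /eqP->; rewrite /E1 eqxx !andbF.
  - by move=> z zS; rewrite inE nx.
  - apply: built_ext Sb => // [z w zS wS|z zS]; last by rewrite /L1 nx.
    by rewrite /E1 !nx ?andbT.
  - by apply: built_vertex; rewrite /E1 eqxx !andbF.
(* D selects the labels to be joined with the new vertex x. *)
pose D l := if l == last_lab then G y x else
   (l != new_lab) && has (fun z => (cls z == l) && G z x) p.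
have Dnew : ~~ D new_lab by rewrite /D eqxx eq_rshift.
(* The latest vertex y must give up its label before x receives it. *)
have := built_relabel new_lab last_lab
  (built_relabel last_lab (cls y) (built_joins Dnew S1)).
have DE z : z \in S -> D (L z) = G z x.
  rewrite mem_rcons inE /L /D.
  case: eqVneq => [-> _|_ /= zp]; first by rewrite eqxx.
  rewrite !eq_lrshift /=; apply/hasP/idP => [[z' z'p]|zx].
    by rewrite eq_lshift => /andP[/eqP/(c_adj es z'p zp)->].
  by exists z; rewrite ?eqxx.
have Lnew z : z \in S -> L1 z == new_lab = false.
  move=> zS; rewrite /L1 nx // /L; case: ifP; first by rewrite eq_rshift.
  by rewrite eq_lrshift.
apply: built_ext => [z|z w|z].
- by rewrite cats1.
- rewrite !cats1 !(mem_rcons S) !(inE, in_cons) /E1.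
  have [zS|zS] := boolP (z \in S); have [wS|wS] := boolP (w \in S);
    rewrite ?orbF ?orbT /=.
  + move=> _ _; rewrite (nx _ zS) (nx _ wS) (Lnew _ zS) (Lnew _ wS).
    by rewrite andbF !andbT orbF.
  + move=> _ /eqP->; rewrite (Lnew _ zS) /L1 (nx _ zS) !eqxx /=.
    by rewrite andbF andbT DE // orbF.
  + move=> /eqP-> _; rewrite (Lnew _ wS) /L1 (nx _ wS) !eqxx /=.
    by rewrite !andbF DE // edge_sym.
  + by move=> /eqP-> /eqP->; rewrite /L1 eqxx (negPf Dnew) !andbF edge_irr.
- rewrite cats1 mem_rcons inE => /orP[/eqP->|zS]; rewrite /L1.
    by rewrite !eqxx eq_rshift /= eqxx.
  rewrite nx // /L; have [->|] := eqVneq z y; first by rewrite eqxx eq_lrshift.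
  by rewrite eq_lrshift /= eq_lrshift.
Qed.

Lemma constructible_caterpillar : V -> s =i V -> constructible G (b + 2).
Proof.
move=> v sV.
have [p [y es]] : exists p y, s = rcons p y.
  by move: (sV v); case/lastP: (s) => // p y _; exists p, y.
have [|t [f [fI fs fE _]]] := @built_prefix p y [::]; first by rewrite cats1.
exists t; exists f => //; apply: inj_card_bij => //.
rewrite -(card_codom fI); apply/subset_leq_card/subsetP => u _.
have /fs[x <-] : u \in rcons p y by rewrite -es sV.
exact: codom_f.
Qed.
End Caterpillar.

(** The injective labelling meets the requirement for any graph. *)
Lemma constructible_some (V : finType) (G : sgraph V) :
  V -> exists k, constructible G k.
Proof.
move=> v; exists (#|V| + 2).
apply: (@constructible_caterpillar _ G _ enum_rank (enum V)) v _.
- exact: enum_uniq.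
- by move=> p y x q _ z z' _ _ /enum_rank_inj->.
- by move=> z; rewrite mem_enum.
Qed.

Lemma constructible_iso (V W : finType) (G : sgraph V) (H : sgraph W) k :
  isomorphic G H -> constructible H k -> constructible G k.
Proof.
move=> [f [f' fK f'K] fE] [t [g [g' gK g'K] gE]]; exists t, (f' \o g).
  by exists (g' \o f) => x /=; rewrite ?f'K ?gK ?g'K ?fK.
by move=> x y; rewrite /= -gE -fE !f'K.
Qed.

(** * Bounded N gives bounded clique-width *)

Definition row_order : rel (nat * nat) := fun u v =>
  (u.2 < v.2) || (u.2 == v.2) && (u.1 <= v.1).

Lemma row_order_total : total row_order.
Proof. by move=> u v; rewrite /row_order; lia. Qed.

Lemma row_order_trans : transitive row_order.
Proof. by move=> u v w; rewrite /row_order; lia. Qed.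

(** If u and w are in the same row, the vertex v strictly between them is in
    that row too, so their columns are not consecutive. *)
Lemma row_order_gap delta u v w : u != v -> v != w ->
    row_order u v -> row_order v w ->
  P_edge delta u w = cross delta u.1 w.1.
Proof.
case: u v w => [i j] [i' j'] [i'' j''].
rewrite /row_order !xpair_eqE /= => ne ne' uv vw.
have [lt|] := ltnP j j''; first exact: P_edge_ltn_row.
move=> ge; have -> : j'' = j by lia.
by apply: P_edge_far; lia.
Qed.

Lemma constructible_of_N_bounded delta b (U : {fset nat * nat}) : U ->
    (forall n, N_param delta (interval 0 n) <= b) ->
  constructible (induced (P delta) U) (b.+1 + 2).
Proof.
move=> u0 Nb; pose n := \max_(u : U) (val u).1.
have [phi phi_cross] := N_param_labelling (ltn0Sn b) (leqW (Nb n)).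
have Un (u : U) : (val u).1 \in interval 0 n.
  by rewrite in_interval /=; apply: (leq_bigmax (F := fun u : U => (val u).1)).
pose le : rel U := fun u v => row_order (val u) (val v).
have le_total : total le by move=> u v; apply: row_order_total.
have le_trans : transitive le by move=> u v w; apply: row_order_trans.
have s_uniq : uniq (sort le (enum {: U})) by rewrite sort_uniq enum_uniq.
apply: (constructible_caterpillar (c := fun u => phi (val u).1) s_uniq) u0 _.
  move=> p y x q es; have := sort_sorted le_total (enum {: U}).
  have := s_uniq; rewrite es sorted_pairwise // => sU; rewrite pairwise_cat /=.
  move=> /and4P[/allrelP pyx _ /andP[yx _] _].
  have gap z : z \in p ->
      P_edge delta (val z) (val x) = cross delta (val z).1 (val x).1.
    move=> zp; apply: (@row_order_gap _ _ (val y)) => //.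
    - rewrite (inj_eq val_inj); apply: contraTneq sU => <-.
      by rewrite cat_uniq /= zp andbF.
    - rewrite (inj_eq val_inj); apply: contraTneq sU => ->.
      by rewrite cat_uniq /= inE eqxx !andbF.
    - by apply: pyx; rewrite ?inE ?eqxx.
  move=> z z' zp z'p e; rewrite /= /induced_edge /= !gap //.
  exact: phi_cross.
by move=> u; rewrite mem_sort mem_enum.
Qed.

Lemma clique_width_min (V : finType) (G : sgraph V) :
  V -> exists k, clique_width G k.
Proof.
move=> /(constructible_some G)[k]; elim/ltn_ind: k => k IH kG.
have [[m mk mG]|none] := classic (exists2 m, m < k & constructible G m).
  exact: IH mG.
exists k; split=> // m mG; rewrite leqNgt; apply/negP => mk.
by case: none; exists m.
Qed.

Theorem theorem3p16 (delta : delta_triple) :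
  unbounded_clique_width (G_class delta) <-> N_unbounded delta.
Proof.
split=> [unb|[j unb] [b cw_b]].
  apply: NNPP => bnd; case: unb.
  have [b Nb] : exists b, forall n, N_param delta (interval 0 n) <= b.
    apply: NNPP => no_b; case: bnd; exists 0 => b; apply: NNPP => no_n.
    case: no_b; exists b => n; rewrite leqNgt; apply/negP => lt.
    by case: no_n; exists n.
  exists (b.+1 + 2) => V G k [U iso] [[t [g _ _]] min_k]; apply: min_k.
  have [f _ _] := iso.
  have x : cw_verts t by elim: t {g} => //= t1 x1 t2 _; left.
  exact: constructible_iso iso (constructible_of_N_bounded (f (g x)) Nb).
have [n jn] := unb (2 ^ b.+1); rewrite ltnNge => /negP; apply.
apply: N_bounded_of_clique_width => // V G GC v.
have [k cwk] := clique_width_min G v.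
by exists k; [apply: cw_b cwk | case: cwk].
Qed.
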